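(* Let $(X,\lambda)$ be a convergence approach space. The reflection of $(X,\lambda)$ in the full subcategory of approach spaces is $(X,\lambda_{\mathrm T})$, where $$\lambda_{\mathrm T}(\mathcal F)(x)=\bigwedge_{B\#\mathcal F}\operatorname{cl}_\lambda B(x)\qquad(\mathcal F\in\mathbb{F}X,\ x\in X).$$ That is: $(X,\lambda_{\mathrm T})$ is an approach space, the identity map is a morphism $(X,\lambda)\to(X,\lambda_{\mathrm T})$, and for every approach space $(Y,\lambda_Y)$, every morphism $f:(X,\lambda)\to(Y,\lambda_Y)$ is also a morphism $f:(X,\lambda_{\mathrm T})\to(Y,\lambda_Y)$.
   Context: Throughout, $V=[0,1]$ with its usual order and $\otimes$ is multiplication (equivalently, via $-\ln$, $V=[0,\infty]^{op}$ with $\otimes=+$). Division is $t\oslash x=\min(t/x,1)$ if $x\neq 0$ and $t\oslash 0=1$. Filters are proper; $\mathbb{F}X$ (resp. $\mathbb{U}X$) is the set of filters (resp. ultrafilters) on $X$, and $\{x\}^{\uparrow}$ is the principal ultrafilter of $x$. $B\#\mathcal F$ means $B\subset X$ and $B\cap F\neq\emptyset$ for all $F\in\mathcal F$. $V^X$ carries the pointwise order. A convergence approach space $(X,\lambda)$ is a set $X$ with a map $\lambda:\mathbb{F}X\to V^X$ such that $\mathcal F\subset\mathcal G$ implies $\lambda(\mathcal F)\le\lambda(\mathcal G)$, and $\lambda(\{x\}^{\uparrow})(x)=1$ for all $x$. A morphism $f:(X,\lambda_X)\to(Y,\lambda_Y)$ is a map with $\lambda_X(\mathcal F)(x)\le\lambda_Y(f[\mathcal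 F])(f(x))$ for all $\mathcal F\in\mathbb{F}X$, $x\in X$, where $f[\mathcal F]$ is the image filter. For $A\subset X$, $\operatorname{adh}A(x)=\bigvee\{\lambda(\mathcal U)(x):\mathcal U\in\mathbb{U}X,\ A\in\mathcal U\}$ (with $\bigvee\emptyset=0$), and $A^{(\epsilon)}=\{x\in X:\operatorname{adh}A(x)\ge\epsilon\}$ for $\epsilon\in V$. $(X,\lambda)$ is a pre-approach space if $\lambda(\bigcap_{\mathcal D\in\mathbb D}\mathcal D)=\bigwedge_{\mathcal D\in\mathbb D}\lambda(\mathcal D)$ for every family $\mathbb D\subset\mathbb{F}X$ (the empty family being excluded, as its intersection is not a proper filter); it is an approach space if moreover $\operatorname{adh}A(x)\ge\operatorname{adh}A^{(\epsilon)}(x)\otimes\epsilon$ for all $A\subset X$, $x\in X$, $\epsilon\in V$. $V$ carries the structure $\lambda_V(\mathcal F)(v)=v\oslash\bigwedge_{F\in\mathcal F}\bigvee F$, and $\mathscr{C}(X,V)$ is the set of morphisms $(X,\lambda)\to(V,\lambda_V)$; it is closed under arbitrary pointwise infima. With $\theta_B$ the indicator function of $B\subset X$, the closure function of $B$ is $\operatorname{cl}_\lambda B=\bigwedge\{g\in\mathscr{C}(X,V):\theta_B\le g\}$ (pointwise infimum), the smallest element of $\mathscr{C}(X,V)$ above $\theta_B$. *)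

(* Defs.v *)
From mathcomp Require Import all_boot all_order all_algebra.
From mathcomp Require Import interval_inference.
From mathcomp Require Import all_classical all_reals.

Set Implicit Arguments.
Unset Strict Implicit.
Unset Printing Implicit Defensive.

Import Order.TTheory GRing.Theory Num.Theory.

Local Open Scope classical_set_scope.
Local Open Scope ring_scope.

(* V = [0,1] is {i01 R}; the join of set0 is 0, its meet is 1. *)
Section V.
Context {R : realType}.
Implicit Types (A : set {i01 R}) (s t x : {i01 R}).

Definition Vsup A : {i01 R} := supremum 0%:i01 A.
Definition Vinf A : {i01 R} := infimum 1%:i01 A.

Definition Vmul t x : {i01 R} := (t%:num * x%:num)%:i01.

Lemma Vdiv_subproof t x : 0 <= Num.min (t%:num / x%:num) 1 <= (1 : R).
Proof.
rewrite ge_min lexx orbT andbT le_min ler01 andbT.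
by rewrite divr_ge0.
Qed.

Definition Vdiv t x : {i01 R} :=
  if x == 0%:i01 then 1%:i01
  else Itv01 (proj1 (andP (Vdiv_subproof t x)))
             (proj2 (andP (Vdiv_subproof t x))).

Lemma Vdiv_residual s t x : (Vmul s x <= t) = (s <= Vdiv t x).
Proof.
rewrite /Vdiv; case: eqVneq => [->|x0].
  by rewrite -!num_le/= mulr0 !ge0 !le1.
have xgt0 : 0 < x%:num.
  rewrite lt_neqAle eq_sym ge0 andbT.
  by apply: contra_neq x0 => x0; exact: val_inj.
by rewrite -!num_le/= le_min le1 andbT ler_pdivlMr.
Qed.

Lemma Vsup_isLub A : isLub A (Vsup A).
Proof.
suff [m [ubm lbm]] : exists m, isLub A m.
  rewrite /Vsup /supremum; case: ifPn => [/eqP ->|_].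
    by split=> [y []|b _]; rewrite -num_le/= ?ge0 ?le1.
  by case: xgetP => [s _ [us ls]|/(_ m)[]]; split.
pose E : set R := [set v%:num | v in A].
have ubE : ubound E 1 by move=> _ [v _ <-].
have [->|/set0P[a Aa]] := eqVneq A set0.
  by exists 0%:i01; split=> [y []|b _]; rewrite -num_le/= ?ge0 ?le1.
have E0 : E !=set0 by exists a%:num, a.
have hE : has_sup E by split => //; exists 1.
have s0 : 0 <= sup E.
  by apply: (@le_trans _ _ a%:num) => //; apply: ub_le_sup; [exists 1|exists a].
have s1 : sup E <= 1 by exact: ge_sup.
exists (Itv01 s0 s1); split=> [v Av|b ubb]; rewrite -num_le/=.
  by apply: ub_le_sup; [exists 1|exists v].
by apply: ge_sup => // _ [v Av <-]; rewrite num_le; exact: ubb.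
Qed.

Lemma Vinf_isGlb A :
  lbound A (Vinf A) /\ forall b, lbound A b -> b <= Vinf A.
Proof.
suff [m [lbm ubm]] : exists m, lbound A m /\ forall b, lbound A b -> b <= m.
  rewrite /Vinf /infimum; case: ifPn => [/eqP ->|_].
    by split=> [y []|b _]; rewrite -num_le/= ?ge0 ?le1.
  by case: xgetP => [s _ [us ls]|/(_ m)[]]; split.
have [ub lub] := Vsup_isLub (lbound A).
exists (Vsup (lbound A)); split=> [y Ay|b lb]; last exact: ub.
by apply: lub => z; apply.
Qed.

End V.

Section Filters.
Context {X : Type}.
Implicit Types (F : pfilter_on X) (D : set (pfilter_on X)).

Definition principal (x : X) : pfilter_on X :=
  PFilterPack (principal_filter x) (principal_filter_proper x).

Definition image_filter {Y : Type} (f : X -> Y) F : pfilter_on Y :=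
  PFilterPack (fmap f F) (fmap_proper_filter f (pfilter_class F)).

Definition mesh (B : set X) F : Prop := forall A : set X, F A -> B `&` A !=set0.

Lemma bigcap_filter_proper D :
  D !=set0 -> ProperFilter (\bigcap_(F in D) (pfilter F : set_system X)).
Proof.
move=> [F0 DF0]; apply: Build_ProperFilter.
  by move=> /(_ _ DF0); exact: filter_not_empty.
split=> [F _|P Q PF QF F DF|P Q PQ PF F DF].
- exact: filterT.
- by apply: filterI; [exact: PF|exact: QF].
- exact: filterS PQ (PF _ DF).
Qed.

Definition bigcap_filter D (D0 : D !=set0) : pfilter_on X :=
  PFilterPack (\bigcap_(F in D) (pfilter F : set_system X))
    (bigcap_filter_proper D0).

End Filters.

Section ConvergenceApproach.
Context {R : realType}.

Definition is_convergence_approach {X : Type}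
    (lam : pfilter_on X -> X -> {i01 R}) : Prop :=
  (forall F G : pfilter_on X, pfilter F `<=` pfilter G ->
     forall x, lam F x <= lam G x) /\
  (forall x, lam (principal x) x = 1%:i01).

Definition is_morphism {X Y : Type} (lamX : pfilter_on X -> X -> {i01 R})
    (lamY : pfilter_on Y -> Y -> {i01 R}) (f : X -> Y) : Prop :=
  forall F x, lamX F x <= lamY (image_filter f F) (f x).

Definition adh {X : Type} (lam : pfilter_on X -> X -> {i01 R})
    (A : set X) (x : X) : {i01 R} :=
  Vsup [set lam U x | U in [set U : pfilter_on X | UltraFilter U /\ U A]].

Definition adh_level {X : Type} (lam : pfilter_on X -> X -> {i01 R})
    (A : set X) (e : {i01 R}) : set X := [set x | e <= adh lam A x].

Definition is_pre_approach {X : Type}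
    (lam : pfilter_on X -> X -> {i01 R}) : Prop :=
  is_convergence_approach lam /\
  forall (D : set (pfilter_on X)) (D0 : D !=set0) (x : X),
    lam (bigcap_filter D0) x = Vinf [set lam F x | F in D].

Definition is_approach {X : Type}
    (lam : pfilter_on X -> X -> {i01 R}) : Prop :=
  is_pre_approach lam /\
  forall (A : set X) (x : X) (e : {i01 R}),
    Vmul (adh lam (adh_level lam A e) x) e <= adh lam A x.

Definition lamV (F : pfilter_on {i01 R}) (v : {i01 R}) : {i01 R} :=
  Vdiv v (Vinf [set Vsup A | A in (pfilter F : set_system {i01 R})]).

Lemma lamV_convergence_approach : is_convergence_approach lamV.
Proof.
split=> [F G FG v|v]; rewrite /lamV.
  rewrite -Vdiv_residual; apply: (@le_trans _ _
    (Vmul (Vdiv v (Vinf [set Vsup A | A in (pfilter F : set_system {i01 R})]))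
          (Vinf [set Vsup A | A in (pfilter F : set_system {i01 R})]))).
    rewrite -num_le/= ler_wpM2l// num_le; apply: (Vinf_isGlb _).2.
    by move=> _ [A FA <-]; apply: (Vinf_isGlb _).1; exists A => //; exact: FG.
  by rewrite Vdiv_residual.
apply/eqP; rewrite eq_le -{1}num_le/= le1/= -Vdiv_residual.
rewrite -num_le/= mul1r num_le; apply: (Vinf_isGlb _).1.
exists [set v]; first by apply/principal_filterP.
by rewrite /Vsup supremum1.
Qed.

Definition V_morphisms {X : Type} (lam : pfilter_on X -> X -> {i01 R}) :
    set (X -> {i01 R}) := [set g | is_morphism lam lamV g].

Definition theta {X : Type} (B : set X) (x : X) : {i01 R} :=
  if `[< B x >] then 1%:i01 else 0%:i01.

Definition closure_fun {X : Type} (lam : pfilter_on X -> X -> {i01 R})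
    (B : set X) (x : X) : {i01 R} :=
  Vinf [set g x | g in [set g | V_morphisms lam g /\
                                forall y, theta B y <= g y]].

Definition lamT {X : Type} (lam : pfilter_on X -> X -> {i01 R})
    (F : pfilter_on X) (x : X) : {i01 R} :=
  Vinf [set closure_fun lam B x | B in [set B | mesh B F]].

End ConvergenceApproach.

(* Main.v *)
Require Import Defs.
From mathcomp Require Import all_boot all_order all_algebra.
From mathcomp Require Import interval_inference.
From mathcomp Require Import all_classical all_reals.

(** Write [B # F] for [mesh B F]. A map [g : X -> V] is a morphism into
    [(V, lamV)] iff [lam F x * e <= g x] whenever [{g >= e} # F]. With this
    test, morphisms into [V] are stable under infima, finite joins and division
    by constants, so [cl] is a morphism, is finitely additive, and satisfies
    [cl {cl A >= e} * e <= cl A]. Moreover [cl] is the adherence of [lamT]: the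
    sets [B] with [cl B x < cl A x] form an ideal, and an ultrafilter
    containing [A] and avoiding it attains [cl A x]. In the universal property,
    [adh B] is a morphism on an approach space [Y], so its composite with [f]
    dominates [cl (f @^-1` B)], and [lamY] is bounded below by the infimum of
    the [adh B] over [B # F]. *)

Import Order.TTheory GRing.Theory Num.Theory.
Local Open Scope classical_set_scope.
Local Open Scope ring_scope.

(** * Order, density and residuation in the unit interval *)

Section UnitInterval.
Context {R : realType}.
Implicit Types (A : set {i01 R}) (s t x : {i01 R}).

Lemma le_Vsup {A x} : A x -> x <= Vsup A.
Proof. by move=> Ax; apply: (Vsup_isLub A).1. Qed.

Lemma Vsup_le {A t} : (forall x, A x -> x <= t) -> Vsup A <= t.
Proof. by move=> At; apply: (Vsup_isLub A).2. Qed.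

Lemma Vinf_le {A x} : A x -> Vinf A <= x.
Proof. by move=> Ax; apply: (Vinf_isGlb A).1. Qed.

Lemma le_Vinf {A t} : (forall x, A x -> t <= x) -> t <= Vinf A.
Proof. by move=> At; apply: (Vinf_isGlb A).2. Qed.

Lemma Vle1 x : x <= 1%:i01.
Proof. by rewrite -num_le/= le1. Qed.

Lemma Vge0 x : 0%:i01 <= x.
Proof. by rewrite -num_le/= ge0. Qed.

Lemma Vmul1 x : Vmul x 1%:i01 = x.
Proof. by apply: val_inj; rewrite /= mulr1. Qed.

Lemma Vmul0 x : Vmul x 0%:i01 = 0%:i01.
Proof. by apply: val_inj; rewrite /= mulr0. Qed.

Lemma VmulA s t x : Vmul s (Vmul t x) = Vmul (Vmul s t) x.
Proof. by apply: val_inj; rewrite /= mulrA. Qed.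

Lemma le_Vmul {s s' t t'} : s <= s' -> t <= t' -> Vmul s t <= Vmul s' t'.
Proof. by rewrite -!num_le/= => ss' tt'; rewrite ler_pM. Qed.

Lemma Vle_dense s t : (forall u, u < s -> u <= t) -> s <= t.
Proof.
move=> st; rewrite leNgt; apply/negP => ts.
have ts' : t%:num < s%:num by rewrite num_lt.
have [tm ms] := midf_lt ts'; set m := (_ / 2) in tm ms.
have m0 : 0 <= m by rewrite (le_trans _ (ltW tm)).
have m1 : m <= 1 by rewrite (le_trans (ltW ms)).
have /st : Itv01 m0 m1 < s by rewrite -num_lt.
by rewrite -num_le/= leNgt tm.
Qed.

(** Residuation turns the bound on the product into a bound on [s] alone, where density applies.
    Commutativity is needed first because [Vdiv_residual] isolates the left factor. *)
Lemma Vmul_le_dense r s t :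
  (forall u, u < s -> Vmul r u <= t) -> Vmul r s <= t.
Proof.
move=> rst; have VmulC : forall a b : {i01 R}, Vmul a b = Vmul b a.
  by move=> a b; apply: val_inj; rewrite /= mulrC.
rewrite VmulC Vdiv_residual; apply: Vle_dense => u /rst.
by rewrite VmulC Vdiv_residual.
Qed.

End UnitInterval.

(** * Meshing and extension to ultrafilters *)

Section Mesh.
Context {X : Type}.
Implicit Types (A B : set X) (F : pfilter_on X).

Lemma meshE A F : mesh A F <-> ~ F (~` A).
Proof.
split=> [AF /AF[x []]//|nFA B FB]; apply: contrapT => AB0.
apply: nFA; apply: filterS FB => x Bx Ax; apply: AB0.
by exists x.
Qed.

Lemma mesh_subset A B F : A `<=` B -> mesh A F -> mesh B F.
Proof. by move=> AB AF C /AF[x [Ax Cx]]; exists x; split => //; exact: AB. Qed.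

Lemma mesh_in A F : F A -> mesh A F.
Proof. by move=> FA B FB; exact: filter_ex (filterI FA FB). Qed.

Lemma meshU A B F : mesh (A `|` B) F -> mesh A F \/ mesh B F.
Proof.
move=> /meshE; rewrite setCU => nF; apply: contrapT => /not_orP[nA nB].
by apply: nF; apply: filterI; apply: contrapT => /meshE.
Qed.

(** For an ideal [N], the sets [B] with [A] minus [B] in [N] form a filter, proper because [A] is
    not in [N]. It contains [A] and the complement of every member of [N], hence so does any
    ultrafilter above it. *)
Lemma ultrafilter_avoiding (N : set (set X)) A :
  N set0 -> (forall B C, N B -> N C -> N (B `|` C)) ->
  (forall B C, B `<=` C -> N C -> N B) -> ~ N A ->
  exists U : pfilter_on X, [/\ UltraFilter U, U A & forall B, U B -> ~ N B].
Proof.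
move=> N0 NU NS NA; pose G : set_system X := [set B | N (A `&` ~` B)].
have GP : ProperFilter G.
  apply: Build_ProperFilter; first by rewrite /G/= setC0 setIT.
  split=> [|B C GB GC|B C BC].
  - by rewrite /G/= setCT setI0.
  - by rewrite /G/= setCI setIUr; exact: NU.
  - by move=> GB; apply: NS GB; apply: setIS; exact: subsetC.
have [U [UU GU]] := ultraFilterLemma GP.
exists (PFilterPack U (ultra_proper (UltraFilter := UU))); split => //=.
  by apply: GU; rewrite /G/= setICr.
move=> B UB NB; apply: (filter_not_empty U).
rewrite -(setICr B); apply: filterI => //; apply: GU.
by rewrite /G/= setCK; apply: NS NB; exact: subIsetr.
Qed.

Lemma ultrafilter_mesh A F : mesh A F ->
  exists U : pfilter_on X, [/\ UltraFilter U, U A & pfilter F `<=` pfilter U].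
Proof.
move=> /meshE nFA.
(* The ideal to avoid consists of the complements of members of [F]. *)
have [|B C|B C BC|//|U [UU UA UN]] :=
    @ultrafilter_avoiding [set B | F (~` B)] A.
- by rewrite /= setC0; exact: filterT.
- by rewrite /= setCU; exact: filterI.
- by move=> /=; apply: filterS; exact: subsetC.
exists U; split => // B FB.
have [//|/UN/=] := in_ultra_setVsetC B UU.
by rewrite setCK.
Qed.

End Mesh.

(** * Morphisms into [V] and their stability *)

Section Morphisms.
Context {R : realType} {X : Type} {lam : pfilter_on X -> X -> {i01 R}}.
Implicit Types (F : pfilter_on X) (g h : X -> {i01 R}).

Lemma V_morphismsP g : V_morphisms lam g <->
  forall F x e, mesh [set y | e <= g y] F -> Vmul (lam F x) e <= g x.
Proof.
split=> [gm F x e eF|gm F x].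
  apply: (@le_trans _ _ (Vmul (lam F x)
      (Vinf [set Vsup A | A in (pfilter (image_filter g F))]))).
    (* Every [A] in the image filter contains some [g y >= e], so its supremum is at least [e]. *)
    apply: le_Vmul => //; apply: le_Vinf => _ [A FA <-].
    by have [y [/= ey Ay]] := eF _ FA; exact: le_trans ey (le_Vsup Ay).
  by rewrite Vdiv_residual; exact: gm.
(* It suffices to treat each [e] strictly below the infimum. If its level set did not mesh [F], then
   [{g < e}] would lie in [F] and the infimum would be at most [e]. *)
rewrite /lamV -Vdiv_residual; apply: Vmul_le_dense => e eF.
apply: gm; apply/meshE => Fe; move: eF; apply/negP; rewrite -leNgt.
apply: (@le_trans _ _ (Vsup [set v | v < e])).
  apply: Vinf_le; exists [set v | v < e] => //=.
  by apply: filterS Fe => y /= /negP; rewrite -ltNge.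
by apply: Vsup_le => v /ltW.
Qed.

Lemma V_morphisms_inf (G : set (X -> {i01 R})) : G `<=` V_morphisms lam ->
  V_morphisms lam (fun x => Vinf [set g x | g in G]).
Proof.
move=> Gm; apply/V_morphismsP => F x e eF.
apply: le_Vinf => _ [g Gg <-]; apply: (V_morphismsP g).1; first exact: Gm.
apply: mesh_subset eF => y /= /le_trans; apply.
by apply: Vinf_le; exists g.
Qed.

Lemma V_morphisms_max g h : V_morphisms lam g -> V_morphisms lam h ->
  V_morphisms lam (fun x => Order.max (g x) (h x)).
Proof.
move=> /V_morphismsP gm /V_morphismsP hm; apply/V_morphismsP => F x e eF.
have /meshU[/gm gx|/hm hx] :
    mesh ([set y | e <= g y] `|` [set y | e <= h y]) F.
- by apply: mesh_subset eF => y /=; rewrite le_max => /orP.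
- by rewrite le_max gx.
- by rewrite le_max hx orbT.
Qed.

(** By residuation, the [e]-level set of the quotient is the level set of [g] at [e * t]. *)
Lemma V_morphisms_div g t : V_morphisms lam g ->
  V_morphisms lam (fun x => Vdiv (g x) t).
Proof.
move=> /V_morphismsP gm; apply/V_morphismsP => F x e eF.
rewrite -Vdiv_residual -VmulA; apply: gm.
by apply: mesh_subset eF => y /=; rewrite Vdiv_residual.
Qed.

Lemma V_morphisms0 : V_morphisms lam (fun=> 0%:i01).
Proof.
apply/V_morphismsP => F x e /(_ _ filterT)[_ [/= e0 _]].
by apply: le_trans (le_Vmul (lexx _) e0) _; rewrite Vmul0.
Qed.

End Morphisms.

Lemma V_morphisms_comp {R : realType} {X Y : Type}
    (lamX : pfilter_on X -> X -> {i01 R}) (lamY : pfilter_on Y -> Y -> {i01 R})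
    (f : X -> Y) (g : Y -> {i01 R}) :
  is_morphism lamX lamY f -> V_morphisms lamY g -> V_morphisms lamX (g \o f).
Proof.
move=> fm /V_morphismsP gm; apply/V_morphismsP => F x e eF.
apply: le_trans (le_Vmul (fm F x) (lexx e)) _; apply: gm.
by move=> A /eF[y [/= ey Ay]]; exists (f y).
Qed.

(** * The closure function and the structure [lamT] *)

Section Closure.
Context {R : realType} {X : Type} {lam : pfilter_on X -> X -> {i01 R}}.
Implicit Types (A B : set X) (F : pfilter_on X) (g : X -> {i01 R}).
Local Notation cl := (closure_fun lam).

Lemma theta_le B g : (forall y, theta B y <= g y) <->
  (forall y, B y -> g y = 1%:i01).
Proof.
split=> gB y => [By|]; last first.
  by rewrite /theta; case: asboolP => [/gB->//|_]; exact: Vge0.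
have := gB y; rewrite /theta asboolT// => g1.
by apply/eqP; rewrite eq_le Vle1.
Qed.

Lemma closure_fun_morphism B : V_morphisms lam (cl B).
Proof. by apply: V_morphisms_inf => g []. Qed.

Lemma closure_fun_le B g x : V_morphisms lam g ->
  (forall y, B y -> g y = 1%:i01) -> cl B x <= g x.
Proof. by move=> gm /theta_le gB; apply: Vinf_le; exists g. Qed.

Lemma closure_fun1 B x : B x -> cl B x = 1%:i01.
Proof.
move: x; apply/theta_le => y.
by apply: le_Vinf => _ [g [_ gB] <-]; exact: gB.
Qed.

Lemma closure_fun_subset A B x : A `<=` B -> cl A x <= cl B x.
Proof.
move=> AB; apply: closure_fun_le => [|y /AB]; first exact: closure_fun_morphism.
exact: closure_fun1.
Qed.

Lemma closure_fun0 x : cl set0 x = 0%:i01.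
Proof.
apply/eqP; rewrite eq_le Vge0 andbT.
exact: (closure_fun_le _ _ _ V_morphisms0).
Qed.

Lemma closure_funU A B x : cl (A `|` B) x <= Order.max (cl A x) (cl B x).
Proof.
apply: (closure_fun_le _ (fun x => Order.max (cl A x) (cl B x))).
  by apply: V_morphisms_max; exact: closure_fun_morphism.
by move=> y [] /closure_fun1 ->; [apply: max_l|apply: max_r]; exact: Vle1.
Qed.

(** The quotient of [cl A] by [e] is a morphism equal to 1 on the level set, so it dominates the
    closure function of that set. *)
Lemma closure_fun_level A x e :
  Vmul (cl [set y | e <= cl A y] x) e <= cl A x.
Proof.
rewrite Vdiv_residual; apply: (closure_fun_le _ (fun x => Vdiv (cl A x) e)).
  exact/V_morphisms_div/closure_fun_morphism.
move=> y /= ey; apply/eqP; rewrite eq_le Vle1/= -Vdiv_residual.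
by rewrite -[leRHS]Vmul1 -!num_le/= mul1r mulr1.
Qed.

Lemma adh_lamT A x : adh (lamT lam) A x = cl A x.
Proof.
apply/eqP; rewrite eq_le; apply/andP; split.
  apply: Vsup_le => _ [U [_ UA] <-].
  by apply: Vinf_le; exists A => //; exact: mesh_in.
(* When [cl A x] is 0, the strict inequality [cl B x < cl A x] excludes even the empty set, so there
   is no ideal to avoid. *)
have [->|clA0] := eqVneq (cl A x) 0%:i01; first exact: Vge0.
have [|B C|B C BC|/=|U [UU UA UN]] :=
    @ultrafilter_avoiding _ [set B | cl B x < cl A x] A.
- by rewrite /= closure_fun0 lt_neqAle Vge0 eq_sym clA0.
- move=> /= BA CA; apply: le_lt_trans (closure_funU B C x) _.
  by rewrite gt_max BA.
- by apply: le_lt_trans; exact: closure_fun_subset.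
- by rewrite ltxx.
apply: (@le_trans _ _ (lamT lam U x)); last by apply: le_Vsup; exists U.
apply: le_Vinf => _ [B BU <-].
have UB : U B.
  by have [//|UB] := in_ultra_setVsetC B UU; move/meshE: BU.
by rewrite leNgt; apply/negP; exact: UN.
Qed.

Lemma lamT_convergence_approach : is_convergence_approach (lamT lam).
Proof.
split=> [F G FG x|x].
  apply: le_Vinf => _ [B BG <-]; apply: Vinf_le; exists B => //.
  by move=> A /FG /BG.
apply/eqP; rewrite eq_le Vle1/=; apply: le_Vinf => _ [B Bx <-].
rewrite closure_fun1//.
have [|y [By]] := Bx [set x]; first exact/principal_filterP.
by move=> /= <-.
Qed.

Lemma lamT_pre_approach : is_pre_approach (lamT lam).
Proof.
split=> [|D D0 x]; first exact: lamT_convergence_approach.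
apply/eqP; rewrite eq_le; apply/andP; split.
  apply: le_Vinf => _ [F DF <-].
  by apply: lamT_convergence_approach.1 => A; exact.
apply: le_Vinf => _ [B BD <-].
(* If [B] meshed no member of [D], its complement would lie in all of them, hence in the
   intersection. *)
have [F DF BF] : exists2 F, D F & mesh B F.
  apply: contrapT => nB; move/meshE: BD; apply => F DF.
  by apply: contrapT => /meshE BF; apply: nB; exists F.
by apply: (@le_trans _ _ (lamT lam F x)); apply: Vinf_le; [exists F|exists B].
Qed.

Lemma lamT_approach : is_approach (lamT lam).
Proof.
split=> [|A x e]; first exact: lamT_pre_approach.
rewrite !adh_lamT; have -> : adh_level (lamT lam) A e = [set y | e <= cl A y].
  by apply/seteqP; split=> y; rewrite /adh_level/= adh_lamT.
exact: closure_fun_level.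
Qed.

Lemma lamT_unit : is_morphism lam (lamT lam) id.
Proof.
move=> F x; apply: le_Vinf => _ [B BF <-].
(* The level test is used at [e = 1], where the level set of [cl B] contains [B]. *)
rewrite -[leLHS]Vmul1; apply: (V_morphismsP _).1; first exact: closure_fun_morphism.
by apply: mesh_subset BF => y By /=; rewrite closure_fun1.
Qed.

End Closure.

(** * Adherence in approach spaces *)

Section Approach.
Context {R : realType} {Y : Type} {lam : pfilter_on Y -> Y -> {i01 R}}.
Implicit Types (B : set Y) (F : pfilter_on Y).

Lemma adh1 B y : is_convergence_approach lam -> B y -> adh lam B y = 1%:i01.
Proof.
move=> [_ lam1] By; apply/eqP; rewrite eq_le Vle1/=.
apply: le_Vsup; exists (principal y) => //; split.
  exact: principal_filter_ultra.
exact/principal_filterP.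
Qed.

(** If the level set meshes [F], an ultrafilter finer than [F] contains it, so [lam F y] is at most
    the adherence of the level set; the tower axiom then concludes. *)
Lemma adh_morphism B : is_approach lam -> V_morphisms lam (adh lam B).
Proof.
move=> [[[lam_homo _] _] tower]; apply/V_morphismsP => F y e.
move=> /ultrafilter_mesh[U [UU Ue FU]].
apply: le_trans (tower B y e); apply: le_Vmul => //.
by apply: le_trans (lam_homo _ _ FU y) _; apply: le_Vsup; exists U.
Qed.

(** For [s] below the infimum, each [B] meshing [F] lies in an ultrafilter whose value at [y] is at
    least [s]. The intersection of all such ultrafilters is therefore contained in [F], and its
    value is at least [s]. *)
Lemma pre_approach_ge_adh F y : is_pre_approach lam ->
  Vinf [set adh lam B y | B in [set B | mesh B F]] <= lam F y.
Proof.
move=> [[lam_homo _] lam_inf]; apply: Vle_dense => s sF.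
pose D := [set U : pfilter_on Y | UltraFilter U /\ s <= lam U y].
have DU B : mesh B F -> exists2 U, D U & U B.
  move=> BF; apply: contrapT => nU; move: sF; apply/negP; rewrite -leNgt.
  apply: (@le_trans _ _ (adh lam B y)); first by apply: Vinf_le; exists B.
  apply: Vsup_le => _ [U [UU UB] <-]; rewrite leNgt; apply/negP => /ltW sU.
  by apply: nU; exists U.
have D0 : D !=set0.
  have [|U DU' _] := DU setT; last by exists U.
  by apply: mesh_in; exact: filterT.
apply: (@le_trans _ _ (lam (bigcap_filter D0) y)).
  by rewrite lam_inf; apply: le_Vinf => _ [U [_ sU] <-].
apply: lam_homo => A DA; apply: contrapT => nFA.
have [|U DU' UA] := DU (~` A); first by apply/meshE; rewrite setCK.
by have [x []] := filter_ex (filterI UA (DA _ DU')).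
Qed.

End Approach.

Theorem theorem21 (R : realType) (X : Type)
    (lam : pfilter_on X -> X -> {i01 R})
    (hlam : is_convergence_approach lam) :
  is_approach (lamT lam) /\
  is_morphism lam (lamT lam) (@id X) /\
  (forall (Y : Type) (lamY : pfilter_on Y -> Y -> {i01 R}),
     is_approach lamY ->
     forall f : X -> Y, is_morphism lam lamY f ->
       is_morphism (lamT lam) lamY f).
Proof.
split; first exact: lamT_approach.
split=> [|Y lamY aY f fm F x]; first exact: lamT_unit.
apply: le_trans (pre_approach_ge_adh _ _ aY.1).
apply: le_Vinf => _ [B BF <-].
(* The preimage of [B] meshes [F] since [B] meshes the image filter, so its closure function bounds
   [lamT lam F x] from above. *)
apply: (@le_trans _ _ (closure_fun lam (f @^-1` B) x)).
  apply: Vinf_le; exists (f @^-1` B) => //.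
  apply/meshE => FB; move/meshE: BF; exact.
apply: (closure_fun_le _ (adh lamY B \o f)).
  exact: V_morphisms_comp fm (adh_morphism _ aY).
by move=> y By; apply: adh1 => //; exact: aY.1.1.
Qed.
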